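(* Let $x \equiv a_j \pmod{m_j}$, $j = 1, \ldots, r$, be a covering system, i.e. a finite system of congruences with positive integer moduli such that every integer satisfies at least one of the congruences. Suppose the moduli $m_1, \ldots, m_r$ are pairwise distinct and each $m_j$ is squarefree (not divisible by the square of any prime). Then $\min_{1\le j\le r} m_j \le 118$. *)

(* Defs.v *)
From mathcomp Require Import all_boot all_order all_algebra.

Set Implicit Arguments.
Unset Strict Implicit.
Unset Printing Implicit Defensive.

Definition squarefree (n : nat) : Prop :=
  forall p : nat, prime p -> ~~ (p ^ 2 %| n).

Definition covering_system (r : nat) (a : 'I_r -> int) (m : 'I_r -> nat) : Prop :=
  (forall j, 0 < m j) /\
  (forall x : int, exists j, (x = a j %[mod (m j)%:Z])%Z).

(* Main.v *)
From Stdlib Require Import NArith.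
Require Import Defs.
From mathcomp Require Import all_boot all_order all_algebra.
From mathcomp Require Import ring lra zify.

(** The distortion method of Balister, Bollobás, Morris, Sahasrabudhe and Tiba
    builds, one prime [p] after another, a probability measure on the residues
    modulo the primes which avoids, as far as a density bound
    [1 / ((1 - delta p) p)] on each new residue allows, the congruences whose
    modulus has largest prime factor [p].  The mass [v p] that such congruences
    retain is [E (alpha - delta p)^+ / (1 - delta p)], with [alpha] the
    proportion of residues modulo [p] covered above a point, and a covering
    would force [1 <= sum v p].

    Here [v p] is estimated by a convex comparison rather than by moments.  One
    has [alpha <= N / p], where [N] counts the congruences matched by the residues
    modulo the primes below [p], and [N] is dominated, for every nondecreasing
    convex function, by the number of admissible divisors of [prod q^(xi q)],
    where the [xi q] are independent Bernoulli variables of means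
    [w q = 1 / ((1 - delta q) q)].  With [delta = 0]
    below [17] and [delta = 1 / 5] from [17] on:
    - for [p <= 23] the comparison expectation is evaluated exactly, taking into
      account that the cofactors below [119 / p] are excluded;
    - for [29 <= p < 6300] the cofactors are not restricted, and the expectation
      of [(2 ^ X - p / 5)^+] only needs the law of [X = sum xi q] on [0..10];
    - beyond, [(y - d)^+ <= y ^ 2 / (4 d)] and the fact that a block of [210]
      consecutive integers contains at most [48] primes make
      [sum_(p < 210 k) v p + prod_(q < 210 k) (1 + 3 w q) / (84 (k - 1))]
      nonincreasing in [k].
    The potential at [k = 30] is about [0.945]. *)

Set Implicit Arguments.
Unset Strict Implicit.
Unset Printing Implicit Defensive.

Import Order.TTheory GRing.Theory Num.Theory.

(** * The distorted measure *)

Section Distortion.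

Local Open Scope ring_scope.

Variables (I : finType) (m : I -> nat) (res : I -> nat -> nat).
Variable delta : nat -> rat.
Hypothesis m_gt1 : forall i, (1 < m i)%N.
Hypothesis delta_ge0 : forall n, 0 <= delta n.
Hypothesis delta_le : forall n, delta n <= 1 / 2.

Implicit Types (v : nat -> nat) (L : seq I) (F G : (nat -> nat) -> rat).

(* A point is a function [v], read modulo [q] at each prime [q]. *)
Definition upd v (n c : nat) : nat -> nat := fun q => if q == n then c else v q.

(** For a squarefree modulus, agreement at every prime divisor is membership in the class; [hit n]
    tests only the prime divisors below [n]. *)
Definition hit n i v : bool :=
  all (fun q => (q < n) ==> (v q %% q == res i q))%N (primes (m i)).

Definition bad n v : bool := [exists i, (max_pdiv (m i) == n) && hit n.+1 i v].

Definition cover_ratio n v : rat :=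
  (\sum_(c < n) bad n (upd v n c))%:R / n%:R.

(** Conditional probability of residue [c] given the coordinates below [n]. If the covered
    proportion [a] is at most [delta n], the uncovered residues share all the mass equally;
    otherwise each of them gets exactly [wmax n] and the covered ones share the rest equally. *)
Definition weight n v (c : nat) : rat :=
  let a := cover_ratio n v in
  let b : rat := (bad n (upd v n c) : nat)%:R in
  if a <= delta n then (1 - b) / (n%:R * (1 - a))
  else (a - b * delta n) / (n%:R * a * (1 - delta n)).

Definition wmax n : rat := (n%:R * (1 - delta n))^-1.

(* Expectation over the coordinates at primes below [n]. *)
Fixpoint Ex n F : rat :=
  if n is k.+1 then
    Ex k (if prime k
          then fun v => \sum_(c < k) weight k v c * F (upd v k c)
          else F)
  else F (fun=> 0%N).

Lemma cover_ratio_ge0 n v : 0 <= cover_ratio n v.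
Proof. by rewrite divr_ge0 ?ler0n. Qed.

Lemma natr_bool (b : bool) : (b : nat)%:R = 0 :> rat \/ (b : nat)%:R = 1 :> rat.
Proof. by case: b; [right | left]. Qed.

Lemma sum_bad n v : (0 < n)%N ->
  \sum_(c < n) ((bad n (upd v n c) : nat)%:R : rat) = n%:R * cover_ratio n v.
Proof.
move=> n0; rewrite /cover_ratio natr_sum mulrCA divff ?mulr1 //.
by rewrite pnatr_eq0 -lt0n.
Qed.

Lemma weight_ge0 n v c : 0 <= weight n v c.
Proof.
rewrite /weight; set b := _%:R; have b0 := natr_bool (bad n (upd v n c)).
rewrite -/b in b0.
have := delta_ge0 n; have := delta_le n; have := cover_ratio_ge0 n v.
set a := cover_ratio n v; set d := delta n => a0 d2 d0; clearbody a d.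
have n0 : 0 <= n%:R :> rat by rewrite ler0n.
case: (lerP a d) => h; apply: divr_ge0; try (by case: b0 => ->; lra).
  by apply: mulr_ge0 => //; lra.
by apply: mulr_ge0; [apply: mulr_ge0 | lra].
Qed.

Lemma weight_le n v c : (0 < n)%N -> weight n v c <= wmax n.
Proof.
move=> n0; rewrite /weight /wmax; set b := _%:R.
have b0 := natr_bool (bad n (upd v n c)); rewrite -/b in b0.
have := delta_ge0 n; have := delta_le n; have := cover_ratio_ge0 n v.
set a := cover_ratio n v; set d := delta n => a0 d2 d0; clearbody a d.
have {}n0 : 0 < n%:R :> rat by rewrite ltr0n.
have bp : 0 <= b by case: b0 => ->.
have nn : n%:R != 0 :> rat by rewrite gt_eqF.
have dn : 1 - d != 0 by apply/eqP; lra.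
case: (lerP a d) => h.
  rewrite ler_pdivrMr ?mulr_gt0 //; last lra.
  have -> : (n%:R * (1 - d))^-1 * (n%:R * (1 - a)) = (1 - a) / (1 - d).
    by field; rewrite nn dn.
  by rewrite ler_pdivlMr; [case: b0 => ->; lra | lra].
have a1 : 0 < a by lra.
have d1 : 0 < 1 - d by lra.
rewrite ler_pdivrMr ?mulr_gt0 //.
have -> : (n%:R * (1 - d))^-1 * (n%:R * a * (1 - d)) = a.
  by field; rewrite nn dn.
have bd : 0 <= b * d by exact: mulr_ge0.
lra.
Qed.

Lemma weight_sum n v : (0 < n)%N -> \sum_(c < n) weight n v c = 1.
Proof.
move=> n0; rewrite /weight.
have := delta_ge0 n; have := delta_le n; have := cover_ratio_ge0 n v.
have := sum_bad v n0.
set a := cover_ratio n v; set d := delta n => sb a0 d2 d0; clearbody a d.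
have {n0}nn : n%:R != 0 :> rat by rewrite pnatr_eq0 -lt0n.
case: (lerP a d) => h; rewrite -big_distrl /= big_split /= sumr_const card_ord.
  have nz : n%:R * (1 - a) != 0 by rewrite mulf_neq0 //; apply/eqP; lra.
  by rewrite sumrN sb -[RHS](divff nz); congr (_ / _); ring.
have nz : n%:R * a * (1 - d) != 0 by rewrite !mulf_neq0 //; apply/eqP; lra.
rewrite sumrN -big_distrl /= sb -[RHS](divff nz) -mulr_natl.
by congr (_ / _); ring.
Qed.

Lemma weight_bad n v : (0 < n)%N ->
  \sum_(c < n) weight n v c * (bad n (upd v n c) : nat)%:R =
  Num.max 0 (cover_ratio n v - delta n) / (1 - delta n).
Proof.
move=> n0; rewrite /weight.
have := delta_ge0 n; have := delta_le n; have := cover_ratio_ge0 n v.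
have := sum_bad v n0.
set a := cover_ratio n v; set d := delta n => sb a0 d2 d0; clearbody a d.
have {n0}nn : n%:R != 0 :> rat by rewrite pnatr_eq0 -lt0n.
case: (lerP a d) => h.
  rewrite max_l ?mul0r; last lra.
  by rewrite big1 // => c _; case: (bad n _); rewrite ?mulr0 // subrr !mul0r.
rewrite max_r; last lra.
transitivity (\sum_(c < n) (bad n (upd v n c) : nat)%:R *
   ((a - d) / (n%:R * a * (1 - d)))).
  by apply: eq_bigr => c _; case: (bad n _); rewrite ?mulr0 ?mul0r // mulr1 !mul1r.
have an : a != 0 by apply/eqP; lra.
have dn : 1 - d != 0 by apply/eqP; lra.
by rewrite -big_distrl /= sb; field; rewrite nn an dn.
Qed.

Lemma Ex_le n F G : (forall v, F v <= G v) -> Ex n F <= Ex n G.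
Proof.
elim: n F G => [|n IH] F G FG /=; first exact: FG.
apply: IH => v; case: ifP => // pn.
by apply: ler_sum => c _; apply: ler_wpM2l; [exact: weight_ge0 | exact: FG].
Qed.

Lemma Ex_eq n F G : (forall v, F v = G v) -> Ex n F = Ex n G.
Proof. by move=> FG; apply: le_anti; rewrite !Ex_le // => v; rewrite FG. Qed.

Lemma Ex_lin n a b F G :
  Ex n (fun v => a * F v + b * G v) = a * Ex n F + b * Ex n G.
Proof.
elim: n F G => [|n IH] F G //=; rewrite -IH; apply: Ex_eq => v.
case: ifP => // pn; rewrite !big_distrr /= -big_split /=.
by apply: eq_bigr => c _; ring.
Qed.

Lemma Ex_local n F : (forall v c, F (upd v n c) = F v) -> Ex n.+1 F = Ex n F.
Proof.
move=> FF /=; apply: Ex_eq => v; case: ifP => // /prime_gt0 pn.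
under eq_bigr => c _ do rewrite FF.
by rewrite -big_distrl /= weight_sum ?mul1r.
Qed.

Lemma Ex_cst n a : Ex n (fun=> a) = a.
Proof. by elim: n => [|n IH] //; rewrite Ex_local. Qed.

Lemma Ex_sum n (J : Type) (s : seq J) (F : J -> (nat -> nat) -> rat) :
  Ex n (fun v => \sum_(j <- s) F j v) = \sum_(j <- s) Ex n (F j).
Proof.
elim: s => [|j s IH].
  by rewrite big_nil -[RHS](Ex_cst n); apply: Ex_eq => v; rewrite big_nil.
rewrite big_cons -IH -[X in X + _]mul1r -[X in _ + X]mul1r -Ex_lin.
by apply: Ex_eq => v; rewrite big_cons !mul1r.
Qed.

Lemma hit_upd n i v c : hit n i (upd v n c) = hit n i v.
Proof.
apply: eq_all => q; rewrite /upd /=; case: (eqVneq q n) => // ->.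
by rewrite ltnn.
Qed.

Lemma hitS n i v : hit n.+1 i v =
  hit n i v && ((n \in primes (m i)) ==> (v n %% n == res i n)%N).
Proof.
apply/allP/andP => [h | [/allP h1 /implyP h2] q qm].
  split; last by apply/implyP => /h; rewrite ltnSn.
  by apply/allP => q /h /implyP h1; apply/implyP => /ltnW qn; apply: h1.
apply/implyP; rewrite ltnS leq_eqVlt => /orP[/eqP qn|]; last exact/implyP/h1.
by rewrite qn in qm *; apply: h2.
Qed.

Lemma mem_primes_m n i : (n \in primes (m i)) = prime n && (n %| m i)%N.
Proof. by rewrite mem_primes (ltnW (m_gt1 i)). Qed.

(** * Convex domination of the number of matched congruences *)

Definition hits n L v : nat := count (fun i => hit n i v) L.

(* [dom n f L] is the expectation of [f] at the number of [i] in [L] such that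
   [xi q = 1] for all primes [q < n] dividing [m i]. *)
Fixpoint dom n (f : nat -> rat) L : rat :=
  if n is k.+1 then
    if prime k then
      (1 - wmax k) * dom k f [seq i <- L | ~~ (k %| m i)%N] + wmax k * dom k f L
    else dom k f L
  else f (size L).

Lemma wmax_ge0 n : 0 <= wmax n.
Proof.
rewrite invr_ge0 mulr_ge0 ?ler0n //.
by have := delta_le n; lra.
Qed.

Lemma wmax_le1 n : prime n -> wmax n <= 1.
Proof.
move=> /prime_gt1 n1; have d := delta_le n.
have n2 : 2 <= n%:R :> rat by rewrite (ler_nat _ 2).
rewrite invf_le1; first nra.
by rewrite mulr_gt0; lra.
Qed.

(** The second clause is discrete convexity: the increments of [f] from [a] are superadditive. *)
Definition convex_nondecr (f : nat -> rat) : Prop :=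
  (forall a b, (a <= b)%N -> f a <= f b) /\
  (forall a s t, f (a + s)%N + f (a + t)%N <= f (a + s + t)%N + f a).

Lemma convex_nondecr_sum f a (s : nat -> nat) n : convex_nondecr f ->
  \sum_(c < n) (f (a + s c)%N - f a) <= f (a + \sum_(c < n) s c)%N - f a.
Proof.
case=> _ fc; elim: n => [|n IH]; first by rewrite !big_ord0 addn0 subrr.
rewrite !big_ord_recr /=; have := fc a (\sum_(c < n) s c)%N (s n).
by rewrite addnA; lra.
Qed.

Lemma sum_residue (n r : nat) : (\sum_(c < n) (c %% n == r)%N <= 1)%N.
Proof.
case: (ltnP r n) => rn.
  rewrite (bigD1 (Ordinal rn)) //= modn_small // eqxx big1 // => c.
  rewrite modn_small // => /negbTE cr; apply/eqP; rewrite eqb0.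
  by rewrite -(inj_eq val_inj) /= in cr; rewrite cr.
rewrite big1 // => c _; apply/eqP; rewrite eqb0 modn_small //.
by rewrite ltn_eqF // (leq_trans _ rn).
Qed.

Lemma sum_count (J : Type) (n : nat) (P : nat -> J -> bool) (s : seq J) :
  (\sum_(c < n) count (P c) s = \sum_(j <- s) \sum_(c < n) P c j)%N.
Proof.
rewrite exchange_big /=; apply: eq_bigr => c _.
by rewrite -sum1_count big_mkcond /=; apply: eq_bigr => j _; case: (P c j).
Qed.

(* Averaging over one coordinate: superadditivity of the increments of [f]
   lets all residues be moved into a single one, of probability [wmax n]. *)
Lemma hits_step n f L v : prime n -> convex_nondecr f ->
  \sum_(c < n) weight n v c * f (hits n.+1 L (upd v n c)) <=
  (1 - wmax n) * f (hits n [seq i <- L | ~~ (n %| m i)%N] v)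
    + wmax n * f (hits n L v).
Proof.
move=> pn fs; have n0 := prime_gt0 pn.
set a := hits n _ v.
pose s c := count (fun i => [&& hit n i v, n %| m i & c %% n == res i n]%N) L.
have hS c : hits n.+1 L (upd v n c) = (a + s c)%N.
  rewrite /a /s /hits count_filter; elim: (L) => //= i K ->.
  rewrite hitS hit_upd {1}/upd eqxx mem_primes_m pn /=.
  by case: (hit n i v); case: (n %| m i)%N; case: (_ == res i n); rewrite /=; lia.
(* A congruence whose modulus is divisible by [n] prescribes one class modulo [n], so it is counted
   in at most one [s c]. *)
have sle : (a + \sum_(c < n) s c <= hits n L v)%N.
  rewrite /a /hits (sum_count n (fun c i => [&& hit n i v, n %| m i & c %% n == res i n]%N)).
  rewrite count_filter; elim: (L) => [|i K IH] /=.
    by rewrite big_nil.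
  rewrite big_cons; have := sum_residue n (res i n).
  case: (hit n i v); case: (n %| m i)%N => /=; rewrite ?big1_eq ?add0n => sr //.
    by rewrite addnCA leq_add.
under eq_bigr => c _ do rewrite hS.
have -> : \sum_(c < n) weight n v c * f (a + s c)%N =
   f a + \sum_(c < n) weight n v c * (f (a + s c)%N - f a).
  under [in RHS]eq_bigr => c _ do rewrite mulrBr.
  by rewrite sumrB -big_distrl /= weight_sum // mul1r addrC subrK.
have h1 : \sum_(c < n) weight n v c * (f (a + s c)%N - f a) <=
          \sum_(c < n) wmax n * (f (a + s c)%N - f a).
  apply: ler_sum => c _; apply: ler_wpM2r; last exact: weight_le.
  by rewrite subr_ge0; apply: fs.1; exact: leq_addr.
have h2 := convex_nondecr_sum a s n fs.
have h3 := fs.1 _ _ sle.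
rewrite -big_distrr /= in h1.
have h4 := ler_wpM2l (wmax_ge0 n) (le_trans h2 (lerB h3 (lexx (f a)))).
by lra.
Qed.

(** [hits_step] integrates out one coordinate, and the two lists it produces are those in the
    recursion of [dom]. *)
Lemma Ex_hits_le n f L : convex_nondecr f ->
  Ex n (fun v => f (hits n L v)) <= dom n f L.
Proof.
move=> fs; elim: n L => [|n IH] L /=.
  by apply: fs.1; exact: count_size.
case: ifP => pn; last first.
  rewrite (Ex_eq _ (G := fun v => f (hits n L v))) // => v.
  by congr f; apply: eq_count => i; rewrite hitS mem_primes_m pn andbT.
apply: (le_trans (Ex_le n (fun v => hits_step L v pn fs))).
rewrite Ex_lin; apply: lerD; apply: ler_wpM2l; rewrite ?IH ?wmax_ge0 //.
by rewrite subr_ge0 wmax_le1.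
Qed.

(** * Mass retained by one layer, and the union bound *)

Definition excess (n : nat) (k : nat) : rat := Num.max 0 (k%:R - n%:R * delta n).

Lemma excess_convex_nondecr n : convex_nondecr (excess n).
Proof.
split=> [a b ab|a s t]; rewrite /excess; set d := n%:R * _.
  by rewrite ge_max !le_max lexx lerD2r ler_nat ab orbT.
have d0 : 0 <= d by rewrite mulr_ge0 ?ler0n.
have s0 : 0 <= s%:R :> rat by rewrite ler0n.
have t0 : 0 <= t%:R :> rat by rewrite ler0n.
rewrite !natrD.
by case: (lerP 0 (a%:R - d)); case: (lerP 0 (a%:R + s%:R - d));
   case: (lerP 0 (a%:R + t%:R - d)); case: (lerP 0 (a%:R + s%:R + t%:R - d)); lra.
Qed.

Definition layer n : seq I := [seq i <- enum I | max_pdiv (m i) == n].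

Lemma sum_bad_le n v : (\sum_(c < n) bad n (upd v n c) <= hits n (layer n) v)%N.
Proof.
apply: (@leq_trans (\sum_(c < n) count (fun i => hit n i v && (c %% n == res i n)%N) (layer n))%N).
  apply: leq_sum => c _; case: (boolP (bad n _)) => //= /existsP[i /andP[/eqP mi]].
  rewrite hitS hit_upd /upd eqxx => /andP[h1 /implyP h2].
  rewrite -has_count; apply/hasP; exists i; first by rewrite mem_filter mi eqxx mem_enum.
  by rewrite h1 h2 // -mi mem_primes_m max_pdiv_prime // max_pdiv_dvd.
rewrite (sum_count n (fun c i => hit n i v && (c %% n == res i n)%N)).
rewrite /hits -sum1_count [X in (_ <= X)%N]big_mkcond /=.
apply: leq_sum => i _; case: (hit n i v); last by rewrite big1.
exact: sum_residue.
Qed.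

Definition layer_bound n : rat := dom n (excess n) (layer n) * wmax n.

(** [weight_bad] gives the mass conditionally on the lower coordinates; bounding [n] times the cover
    ratio by the number of hits makes it a convex function of that number. *)
Lemma Ex_bad_le n : prime n ->
  Ex n.+1 (fun v => (bad n v : nat)%:R) <= layer_bound n.
Proof.
move=> pn; have n0 := prime_gt0 pn.
have d2 := delta_le n.
rewrite /= pn (Ex_eq n (fun v => weight_bad v n0)).
have le1 v : Num.max 0 (cover_ratio n v - delta n) / (1 - delta n) <=
    wmax n * excess n (hits n (layer n) v) + 0 * 0.
  have nR : 0 < n%:R :> rat by rewrite ltr0n.
  have d1 : 0 < 1 - delta n by lra.
  have hle : n%:R * cover_ratio n v <= (hits n (layer n) v)%:R.
    by rewrite -sum_bad // -natr_sum ler_nat sum_bad_le.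
  rewrite mul0r addr0 /wmax invfM mulrC [X in _ <= X]mulrAC [X in _ <= X]mulrC.
  apply: ler_wpM2l; first by rewrite invr_ge0 ltW.
  rewrite mulrC ler_pdivlMr // mulrC /excess.
  have n0' := ltW nR.
  case: (lerP 0 (cover_ratio n v - delta n)) => h1; last by rewrite mulr0 le_max lexx.
  by rewrite le_max mulrBr lerD2r hle orbT.
apply: (le_trans (Ex_le n le1)).
rewrite Ex_lin mul0r addr0 /layer_bound mulrC.
by apply: ler_wpM2r; rewrite ?wmax_ge0 // Ex_hits_le //; exact: excess_convex_nondecr.
Qed.

Lemma bad_upd n k v c : (n < k)%N -> bad n (upd v k c) = bad n v.
Proof.
move=> nk; apply: eq_existsb => i; congr (_ && _); apply: eq_all => q.
by rewrite /= ltnS /upd; case: (eqVneq q k) => // ->; rewrite leqNgt nk.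
Qed.

Lemma Ex_bad_widen n k : (n < k)%N ->
  Ex k (fun v => (bad n v : nat)%:R) = Ex n.+1 (fun v => (bad n v : nat)%:R).
Proof.
elim: k => // k IH; rewrite ltnS leq_eqVlt => /orP[/eqP -> // | nk].
by rewrite Ex_local ?IH // => v c; rewrite bad_upd.
Qed.

(** If every point is bad at some level, the indicators add up to at least 1 everywhere, and so do
    their expectations; nonprime levels contribute nothing. *)
Lemma not_always_bad M :
  (forall v, exists2 n, (n < M)%N & bad n v) ->
  1 <= \sum_(n <- iota 0 M | prime n) layer_bound n.
Proof.
move=> allbad.
have badF n v : ~~ prime n -> bad n v = false.
  move=> pn; apply/existsP => -[i /andP[/eqP mi _]].
  by rewrite -mi max_pdiv_prime in pn.
rewrite -(Ex_cst M 1).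
apply: (@le_trans _ _ (Ex M (fun v => \sum_(n <- iota 0 M) (bad n v : nat)%:R))).
  apply: Ex_le => v; case: (allbad v) => n nM bv.
  rewrite (big_rem n) ?mem_iota //= bv lerDl.
  by rewrite sumr_ge0 // => k _; rewrite ler0n.
rewrite Ex_sum [X in _ <= X]big_mkcond /= big_seq [X in _ <= X]big_seq.
apply: ler_sum => n; rewrite mem_iota /= => nM; rewrite Ex_bad_widen //.
case: ifP => pn; first exact: Ex_bad_le.
by rewrite (Ex_eq _ (G := fun=> 0)) ?Ex_cst // => v; rewrite badF ?pn.
Qed.

End Distortion.

(** * The Bernoulli comparison *)

Fixpoint prod_divisors (O : seq nat) : seq nat :=
  if O is q :: O' then prod_divisors O' ++ map (muln q) (prod_divisors O')
  else [:: 1].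

Lemma size_prod_divisors O : size (prod_divisors O) = 2 ^ size O.
Proof.
by elim: O => //= q O IH; rewrite size_cat size_map IH expnS mul2n addnn.
Qed.

Lemma mem_prod_divisors O d :
  all prime O -> d %| \prod_(q <- O) q -> d \in prod_divisors O.
Proof.
elim: O d => [|q O IH] d /=; first by rewrite big_nil dvdn1 inE.
case/andP=> pq pO; rewrite big_cons mem_cat => dq.
case: (boolP (q %| d)) => qd; last first.
  by rewrite IH // -(Gauss_dvdr _ (n := q)) // coprime_sym prime_coprime.
apply/orP; right; case/dvdnP: qd => e de; rewrite de mulnC in dq *.
by apply: map_f; apply: IH => //; move: dq; rewrite dvdn_pmul2l // prime_gt0.
Qed.

Lemma squarefree_dvd_prod d O : 0 < d -> squarefree d ->
  {subset primes d <= O} -> d %| \prod_(q <- O) q.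
Proof.
move=> d0 sd dO; apply/dvdn_partP => // q qd.
have pq : prime q by move: qd; rewrite mem_primes => /andP[].
have /(_ q) := sd; rewrite pfactor_dvdn // -ltnNge => /(_ pq) l1.
have qO := dO _ qd.
rewrite p_part; apply: (@dvdn_trans q).
  by case: (logn q d) l1 => [|[|]] //; rewrite ?dvd1n // expn1.
by rewrite (big_rem q) //= dvdn_mulr.
Qed.

Lemma squarefree_dvdn d n : d %| n -> squarefree n -> squarefree d.
Proof. by move=> dn sn p pp; apply: contra (sn p pp) => /dvdn_trans; apply. Qed.

(** * Counting cofactors as divisors of a random product *)

Section Envelope.

Local Open Scope ring_scope.

Variable delta : nat -> rat.
Hypothesis delta_le : forall n, delta n <= 1 / 2.
Local Notation w := (wmax delta).

(* In [tree] the list [O] collects the primes with [xi q = 1]; [chain] only keeps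
   their number. *)
Fixpoint tree n (g : seq nat -> rat) (O : seq nat) : rat :=
  if n is k.+1 then
    if prime k then (1 - w k) * tree k g O + w k * tree k g (k :: O)
    else tree k g O
  else g O.

(* For distinct primes [O], the number of divisors of [prod O] that are at least [T]. *)
Definition large_divisors T (O : seq nat) : nat :=
  (2 ^ size O - count (dvdn^~ (\prod_(q <- O) q)) (iota 1 T.-1))%N.

(** Once all primes are decided, each prime of a surviving [m i] is [p] or lies in [O], so the
    cofactors [m i %/ p] are distinct divisors of the product of [O], each at least [T]. The last
    hypothesis is the invariant of the induction on [n]. *)
Lemma dom_le_tree (I : finType) (m : I -> nat) p T f n L O :
  (forall a b, (a <= b)%N -> f a <= f b) ->
  injective m -> (forall i, 0 < m i)%N -> (forall i, squarefree (m i)) ->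
  prime p -> uniq L -> all prime O ->
  {in L, forall i, (p %| m i)%N && (T <= m i %/ p)%N} ->
  {in L, forall i q, q \in primes (m i) -> [|| (q < n)%N, q == p | q \in O]} ->
  dom m delta n f L <= tree n (f \o large_divisors T) O.
Proof.
move=> fle minj m0 msf pp; elim: n L O => [|n IH] L O uL pO hL hO /=.
  apply: fle; rewrite /large_divisors leq_subRL; last first.
    rewrite -size_prod_divisors -size_filter; apply: uniq_leq_size.
      by rewrite filter_uniq // iota_uniq.
    by move=> d; rewrite mem_filter => /andP[dO _]; apply: mem_prod_divisors.
  (* The divisors of the product of [O] below [T] and the cofactors together form a repetition-free
     list of divisors of that product. *)
  rewrite -size_prod_divisors -size_filter -(size_map (fun i => m i %/ p)%N L) -size_cat.
  apply: uniq_leq_size.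
    rewrite cat_uniq filter_uniq ?iota_uniq //= map_inj_in_uniq ?uL ?andbT.
      apply/hasPn => d /mapP[i /hL /andP[_ Ti] ->]; rewrite mem_filter mem_iota.
      by rewrite negb_and; apply/orP; right; apply/negP; move: Ti; lia.
    move=> i j /hL /andP[pi _] /hL /andP[pj _] eij; apply: minj.
    by rewrite -(divnK pi) eij divnK.
  move=> d; rewrite mem_cat => /orP[|/mapP[i iL ->]].
    by rewrite mem_filter => /andP[dO _]; apply: mem_prod_divisors.
  apply: mem_prod_divisors => //; have /andP[pi _] := hL i iL.
  have dm : (m i %/ p %| m i)%N by rewrite -{2}(divnK pi) dvdn_mulr.
  have d0 : (0 < m i %/ p)%N by rewrite divn_gt0 ?prime_gt0 // dvdn_leq.
  apply: squarefree_dvd_prod => //; first exact: squarefree_dvdn dm (msf i).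
  move=> q qm; have qi : q \in primes (m i).
    by move: qm; rewrite !mem_primes m0 => /and3P[-> _ /dvdn_trans->].
  case/or3P: (hO i iL q qi) => // /eqP qp.
  (* A cofactor divisible by [p] would make [p ^ 2] divide [m i]. *)
  have := msf i p pp; rewrite -{1}(divnK pi) mulnC expnS expn1 dvdn_pmul2l ?prime_gt0 //.
  by move: qm; rewrite mem_primes qp => /and3P[_ _ ->].
case: ifP => pn; last first.
  apply: IH => // i iL q qm; move: (hO i iL q qm); rewrite ltnS leq_eqVlt.
  case: (eqVneq q n) qm => [->|] //; by rewrite mem_primes pn.
have w1 : 0 <= 1 - w n by rewrite subr_ge0 wmax_le1.
apply: lerD; apply: ler_wpM2l => //; try exact: wmax_ge0.
  apply: IH; rewrite ?filter_uniq //.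
    by move=> i; rewrite mem_filter => /andP[_]; exact: hL.
  move=> i; rewrite mem_filter => /andP[ni iL] q qm.
  move: (hO i iL q qm); rewrite ltnS leq_eqVlt.
  case: (eqVneq q n) qm => [->|] //.
  by rewrite mem_primes (negbTE ni) !andbF.
apply: IH; rewrite //= ?pn // => i iL q qm.
move: (hO i iL q qm); rewrite ltnS leq_eqVlt inE.
by case: (eqVneq q n); rewrite /= ?orbT.
Qed.

Fixpoint chain n (h : nat -> rat) (k : nat) : rat :=
  if n is j.+1 then
    if prime j then (1 - w j) * chain j h k + w j * chain j h k.+1
    else chain j h k
  else h k.

Lemma tree_chain n h O : tree n (h \o size) O = chain n h (size O).
Proof. by elim: n O => //= n IH O; case: ifP; rewrite !IH. Qed.

Lemma eq_tree n g1 g2 O : g1 =1 g2 -> tree n g1 O = tree n g2 O.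
Proof. by move=> e; elim: n O => //= n IH O; rewrite !IH. Qed.

Lemma large_divisors1 O : large_divisors 1 O = (2 ^ size O)%N.
Proof. by rewrite /large_divisors /= subn0. Qed.

Lemma tree_large_divisors1 n f :
  tree n (f \o large_divisors 1) [::] = chain n (fun k => f (2 ^ k)%N) 0.
Proof.
by rewrite -(tree_chain _ _ [::]); apply: eq_tree => O /=; rewrite large_divisors1.
Qed.

Lemma chain_le n h1 h2 k : (forall j, h1 j <= h2 j) -> chain n h1 k <= chain n h2 k.
Proof.
move=> hh; elim: n k => //= n IH k; case: ifP => pn //.
have w1 : 0 <= 1 - w n by rewrite subr_ge0 wmax_le1.
by apply: lerD; apply: ler_wpM2l => //; apply: wmax_ge0.
Qed.

Lemma eq_chain n h1 h2 k : h1 =1 h2 -> chain n h1 k = chain n h2 k.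
Proof. by move=> e; elim: n k => //= n IH k; rewrite !IH. Qed.

Lemma chain_lin n a b h1 h2 k :
  chain n (fun j => a * h1 j + b * h2 j) k = a * chain n h1 k + b * chain n h2 k.
Proof. by elim: n k => //= n IH k; case: ifP => // _; rewrite !IH; ring. Qed.

Lemma chain_shift n h k : chain n h k.+1 = chain n (h \o succn) k.
Proof. by elim: n k => //= n IH k; rewrite !IH. Qed.

(** By [chain_exp] this is the mean of [(1 + c) ^ X], with [X] the number of primes [q < n] such
    that [xi q = 1]; [c = 1] gives the mean of [2 ^ X] and [c = 3] its second moment. *)
Definition growth (c : rat) n : rat := \prod_(k <- iota 0 n | prime k) (1 + c * w k).

Lemma growthS c n :
  growth c n.+1 = growth c n * (if prime n then 1 + c * w n else 1).
Proof.
rewrite /growth -addn1 iotaD big_cat /= add0n big_cons big_nil.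
by case: ifP; rewrite ?mulr1.
Qed.

Lemma chain_exp n (c : rat) k : chain n (fun j => (1 + c) ^+ j) k = (1 + c) ^+ k * growth c n.
Proof.
elim: n k => [|n IH] k; first by rewrite /growth big_nil mulr1.
rewrite growthS /=; case: ifP => _; rewrite !IH ?mulr1 // exprS; ring.
Qed.

Lemma chain_cst n a k : chain n (fun=> a) k = a.
Proof. by elim: n k => //= n IH k; rewrite !IH; case: ifP => // _; ring. Qed.

Definition pmf n j : rat := chain n (fun k => (k == j)%:R) 0.

Lemma pmfS n j : pmf n.+1 j =
  if prime n then (1 - w n) * pmf n j + w n * (if j is i.+1 then pmf n i else 0)
  else pmf n j.
Proof.
rewrite /pmf /= chain_shift; case: ifP => // _; congr (_ + _ * _).
case: j => [|j]; last exact: eq_chain.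
by rewrite -[RHS](chain_cst n _ 0); exact: eq_chain.
Qed.

Lemma chain_sum n (s : seq nat) (c : nat -> rat) h k :
  chain n (fun j => \sum_(i <- s) c i * h i j) k = \sum_(i <- s) c i * chain n (h i) k.
Proof.
elim: s => [|i s IH].
  by rewrite big_nil -[RHS](chain_cst n _ k); apply: eq_chain => j; rewrite big_nil.
rewrite big_cons -IH -[X in _ = _ + X]mul1r -chain_lin.
by apply: eq_chain => j; rewrite big_cons mul1r.
Qed.

End Envelope.

(** * Levels and tail *)

Section Inequalities.

Local Open Scope ring_scope.

Variable R : realFieldType.
Implicit Types x y : R.

(** With [d = y / 5] this is [x - d <= x ^ 2 / (4 * d)], from [(x - 2 * d) ^ 2 >= 0]. *)
Lemma sub_quarter_square x y : 0 < y -> x - y / 5 <= 5 / (4 * y) * (x * x).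
Proof.
move=> y0; rewrite mulrAC ler_pdivlMr ?mulr_gt0 //.
by have := sqr_ge0 (5 * x - 2 * y); rewrite expr2; nra.
Qed.

(** Reversed Bernoulli inequality; the induction rests on
    [(1 + x) * (1 - (n + 1) * x) <= 1 - n * x]. *)
Lemma bernoulli_inv x n : 0 <= x -> n%:R * x <= 1 ->
  (1 + x) ^+ n * (1 - n%:R * x) <= 1.
Proof.
move=> x0; elim: n => [|n IH] nx; first by rewrite mul0r subr0 mul1r.
rewrite -natr1 in nx *.
have {}IH : (1 + x) ^+ n * (1 - n%:R * x) <= 1 by apply: IH; lra.
apply: le_trans IH; rewrite exprSr -mulrA.
apply: ler_wpM2l; first by rewrite exprn_ge0 //; lra.
have n0 : 0 <= n%:R :> R by rewrite ler0n.
nra.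
Qed.

(** Here [48] bounds the number of primes in a block, and [56] comes from
    [3 * 5 / (4 * 210) = 1 / 56]. *)
Lemma bernoulli_block x : 2 <= x ->
  (1 + (56 * x)^-1) ^+ 48 * (7 * x - 6) <= 7 * x.
Proof.
move=> x2; have x0 : 0 < x by lra.
have xn : x != 0 by rewrite gt_eqF.
have := @bernoulli_inv (56 * x)^-1 48.
have -> : 48%:R * (56 * x)^-1 = 6 / (7 * x) by field; rewrite xn.
have -> : 1 - 6 / (7 * x) = (7 * x - 6) / (7 * x) by field; rewrite xn.
rewrite mulrA !ler_pdivrMr ?mulr_gt0 // !mul1r => -> //; last lra.
by rewrite invr_ge0 mulr_ge0 // ltW.
Qed.

Lemma weight_block x y : 0 < x -> 210 * x <= y -> 3 * (5 / (4 * y)) <= (56 * x)^-1.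
Proof.
move=> x0 yx; have y0 : 0 < y by lra.
rewrite mulrA ler_pdivrMr ?mulr_gt0 // [X in _ <= X]mulrC ler_pdivlMr ?mulr_gt0 //.
by lra.
Qed.

Lemma square_block x y : 0 < x -> 210 * x <= y ->
  25 / (16 * y ^+ 2) <= ((168 * x) ^+ 2)^-1.
Proof.
move=> x0 yx; have y0 : 0 < y by lra.
rewrite ler_pdivrMr ?mulr_gt0 ?exprn_gt0 // [X in _ <= X]mulrC ler_pdivlMr ?mulr_gt0 ?exprn_gt0 //.
have : (210 * x) ^+ 2 <= y ^+ 2 by rewrite ler_sqr ?nnegrE //; lra.
by rewrite !exprMn; lra.
Qed.

(** [x] is the block index, [g] and [g'] the growth at its two ends, and the first term bounds the
    levels inside. After clearing denominators and multiplying by [7 * x - 6], the slack is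
    [588 * g * x]. *)
Lemma potential_block (g g' x : R) : 2 <= x -> 0 <= g -> 0 <= g' ->
  g' * (7 * x - 6) <= g * (7 * x) ->
  g' / (12 * (7 * x) ^+ 2) + g' / (84 * x) <= g / (84 * (x - 1)).
Proof.
move=> x2 g0 g'0 gg; have xn : x != 0 by apply/eqP; lra.
have -> : g' / (12 * (7 * x) ^+ 2) + g' / (84 * x) = g' * (7 * x + 1) / (12 * (7 * x) ^+ 2).
  by field; rewrite xn.
have x3 : 0 < x - 1 by lra.
have x4 : 0 < x by lra.
have x5 : 0 < 7 * x - 6 by lra.
rewrite ler_pdivrMr ?mulr_gt0 ?exprn_gt0 // mulrAC ler_pdivlMr ?mulr_gt0 //.
rewrite -(ler_pM2r x5).
have h : g' * (7 * x - 6) * ((7 * x + 1) * (84 * (x - 1))) <=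
         g * (7 * x) * ((7 * x + 1) * (84 * (x - 1))).
  by apply: ler_wpM2r => //; rewrite !mulr_ge0 //; lra.
have h2 : 0 <= g * x by rewrite mulr_ge0 // ltW.
have e : g * (12 * (7 * x) ^+ 2) * (7 * x - 6) - g * (7 * x) * ((7 * x + 1) * (84 * (x - 1)))
  = 12 * 49 * (g * x) by ring.
have -> : g' * (7 * x + 1) * (84 * (x - 1)) * (7 * x - 6) =
   g' * (7 * x - 6) * ((7 * x + 1) * (84 * (x - 1))) by ring.
lra.
Qed.

Lemma tail_factor (g x : R) : x != 0 ->
  25 / (16 * x ^+ 2) * g = 5 / (4 * x) * (5 / (4 * x) * g + 0 * 0).
Proof. by move=> x0; field; rewrite x0. Qed.

Lemma block_average (g x : R) : x != 0 ->
  g / (12 * (7 * x) ^+ 2) = (g * ((168 * x) ^+ 2)^-1) *+ 48.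
Proof. by move=> x0; rewrite -mulr_natr; field; rewrite x0. Qed.

End Inequalities.

(** * Bounds for a single prime *)

Section Levels.

Local Open Scope ring_scope.

Definition dist (n : nat) : rat := if (n < 17)%N then 0 else 1 / 5.

Lemma dist_ge0 n : 0 <= dist n.
Proof. by rewrite /dist; case: ifP => _; lra. Qed.

Lemma dist_le n : dist n <= 1 / 2.
Proof. by rewrite /dist; case: ifP => _; lra. Qed.

Local Notation w := (wmax dist).

(* The least [d] with [119 <= n * d]. *)
Definition min_cofactor (n : nat) : nat := (118 %/ n).+1.

Definition level_bound (n : nat) : rat :=
  w n * (if (n < 24)%N
         then tree dist n (excess dist n \o large_divisors (min_cofactor n)) [::]
         else chain dist n (fun k => excess dist n (2 ^ k)) 0).

Definition total_bound n : rat := \sum_(k <- iota 0 n | prime k) level_bound k.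

Lemma totalS n : total_bound n.+1 = total_bound n + (if prime n then level_bound n else 0).
Proof.
rewrite /total_bound -addn1 iotaD big_cat /= add0n big_cons big_nil.
by case: ifP; rewrite ?addr0.
Qed.

Lemma wmax_large n : (17 <= n)%N -> w n = 5 / (4 * n%:R).
Proof.
move=> n17; rewrite /wmax /dist ltnNge n17 /=.
have n0 : n%:R != 0 :> rat by rewrite pnatr_eq0 -lt0n; lia.
by field; rewrite n0.
Qed.

Lemma wmax_small n : (n < 17)%N -> w n = n%:R^-1.
Proof. by move=> n17; rewrite /wmax /dist n17 subr0 mulr1. Qed.

Lemma excess_large n k : (17 <= n)%N ->
  excess dist n k = Num.max 0 (k%:R - n%:R / 5).
Proof. by move=> n17; rewrite /excess /dist ltnNge n17 /= mul1r. Qed.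

(** The positive part of [t - d] is [t - d] plus the positive part of [d - t], with [t = 2 ^ X] and
    [d = n / 5]; the latter vanishes for [X >= 11] because [d <= 2 ^ 11]. *)
Lemma chain_excess n : (17 <= n <= 5 * 2 ^ 11)%N ->
  chain dist n (fun k => excess dist n (2 ^ k)) 0 =
  growth dist 1 n - n%:R / 5
  + \sum_(j <- iota 0 11) Num.max 0 (n%:R / 5 - (2 ^ j)%:R) * pmf dist n j.
Proof.
case/andP=> n17 nle.
rewrite -(chain_sum dist n _ (fun j => Num.max 0 (n%:R / 5 - (2 ^ j)%:R))
            (fun j k => (k == j)%:R)).
have -> : growth dist 1 n = chain dist n (fun k => (1 + 1) ^+ k) 0.
  by rewrite chain_exp mul1r.
rewrite -[X in _ = _ - X + _](chain_cst dist n _ 0) -[X in _ = X - _ + _]mul1r.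
rewrite -mulN1r -chain_lin -[X in _ = X + _]mul1r -[X in _ = _ + X]mul1r -chain_lin.
apply: eq_chain => k; rewrite excess_large // !mul1r mulN1r natrX.
have -> : (1 + 1 : rat) = 2 by [].
case: (ltnP k 11) => k11; last first.
  rewrite big_seq big1 => [|j]; last first.
    rewrite mem_iota => /andP[_ j11]; rewrite (gtn_eqF (leq_trans j11 k11)).
    by rewrite mulr0.
  rewrite addr0 max_r // subr_ge0 ler_pdivrMr //.
  rewrite -natrX -(natrM _ _ 5) ler_nat mulnC (leq_trans nle) //.
  by rewrite leq_mul2l leq_exp2l.
rewrite (bigD1_seq k) ?mem_iota ?iota_uniq //= eqxx mulr1 big1 => [|j /negbTE jk].
  rewrite addr0 natrX.
  by case: (lerP 0 (2 ^+ k - n%:R / 5)); case: (lerP 0 (n%:R / 5 - 2 ^+ k)); lra.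
by rewrite eq_sym jk mulr0.
Qed.

(** The excess at [2 ^ X] is at most [5 / (4 * n)] times [4 ^ X], whose mean is [growth dist 3 n];
    [w n] supplies another factor [5 / (4 * n)]. *)
Lemma level_bound_tail n : (24 <= n)%N ->
  level_bound n <= 25 / (16 * n%:R ^+ 2) * growth dist 3 n.
Proof.
move=> n24; have n17 : (17 <= n)%N by apply: leq_trans n24.
have n0 : 0 < n%:R :> rat by rewrite ltr0n; lia.
have nn : n%:R != 0 :> rat by rewrite gt_eqF.
rewrite /level_bound ifF ?(wmax_large n17); last by rewrite ltnNge n24.
rewrite (tail_factor _ nn); apply: ler_wpM2l.
  by rewrite mulr_ge0 ?invr_ge0 ?mulr_ge0 ?ler0n.
rewrite -[growth _ _ _]mul1r -(chain_exp dist n 3 0) -[X in _ <= _ + _ * X](chain_cst dist n 0 0).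
rewrite -chain_lin; apply: chain_le; first exact: dist_le.
move=> j; rewrite excess_large // mul0r addr0 natrX.
have -> : (1 + 3 : rat) = 2 * 2 by ring.
rewrite exprMn ge_max (sub_quarter_square _ n0) andbT.
by rewrite !mulr_ge0 ?invr_ge0 ?mulr_ge0 ?exprn_ge0 ?ler0n.
Qed.

End Levels.

(** * Decay of the potential over blocks of 210 integers *)

Section Tail.

Local Open Scope ring_scope.

Local Notation w := (wmax dist).
Local Notation G := (growth dist 3).

(** Primes above 7 are coprime to 210, whose totient is 48; [0 < k] keeps 2, 3, 5 and 7 out of the
    block. *)
Lemma count_prime_block k : (0 < k)%N ->
  (count prime (iota (210 * k) 210) <= 48)%N.
Proof.
move=> k0; apply: (@leq_trans (count (coprime 210) (iota (210 * k) 210))).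
  rewrite -!size_filter; apply: uniq_leq_size; first by rewrite filter_uniq ?iota_uniq.
  move=> n; rewrite !mem_filter mem_iota => /and3P[pn n1 ->]; rewrite n1 !andbT.
  rewrite coprime_sym prime_coprime //; apply/negP => /dvdn_leq.
  move=> /(_ isT) n210; have n2 : n = 210%N by lia.
  by move: pn; rewrite n2.
rewrite -{1}(addn0 (210 * k)%N) iotaDl count_map.
rewrite (eq_count (a2 := coprime 210)) //.
by move=> j /=; rewrite /coprime mulnC gcdnMDl.
Qed.

Lemma growth_ge0 n : 0 <= G n.
Proof.
rewrite /growth prodr_ge0 // => k _; have := wmax_ge0 dist_le k; lra.
Qed.

Lemma growth_le n j : G n <= G (n + j).
Proof.
elim: j => [|j IH]; first by rewrite addn0.
rewrite addnS growthS; apply: (le_trans IH); rewrite ler_peMr ?growth_ge0 //.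
case: ifP => // _; have := wmax_ge0 dist_le (n + j); lra.
Qed.

Lemma wmax_block k n : (0 < k)%N -> (210 * k <= n)%N -> 3 * w n <= (56 * k%:R)^-1.
Proof.
move=> k0 nk; have n17 : (17 <= n)%N by lia.
rewrite (wmax_large n17).
apply: weight_block; first by rewrite ltr0n.
by rewrite -(natrM _ 210) ler_nat.
Qed.

Lemma prod_block k : (0 < k)%N ->
  \prod_(n <- iota (210 * k) 210 | prime n) (1 + 3 * w n) <= (1 + (56 * k%:R)^-1) ^+ 48.
Proof.
move=> k0.
have x0 : 0 <= (56 * k%:R)^-1 :> rat by rewrite invr_ge0 mulr_ge0 ?ler0n.
apply: (@le_trans _ _ (\prod_(n <- iota (210 * k) 210 | prime n) (1 + (56 * k%:R)^-1))).
  rewrite big_seq_cond [X in _ <= X]big_seq_cond; apply: ler_prod => n.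
  rewrite mem_iota => /andP[/andP[nk _] _].
  rewrite lerD2l (wmax_block k0 nk) andbT; apply: addr_ge0; first exact: ler01.
  by apply: mulr_ge0; [exact: (ler0n _ 3) | exact: wmax_ge0 dist_le n].
rewrite big_const_seq iter_mulr_1.
by apply: ler_weXn2l; [rewrite lerDl | exact: count_prime_block].
Qed.

Lemma growth_block k : (1 < k)%N ->
  G (210 * k.+1) * (7 * k%:R - 6) <= G (210 * k) * (7 * k%:R).
Proof.
move=> k1; have k2 : 2 <= k%:R :> rat by rewrite (ler_nat _ 2).
have -> : G (210 * k.+1) =
    G (210 * k) * \prod_(n <- iota (210 * k) 210 | prime n) (1 + 3 * w n).
  by rewrite /growth mulnS addnC iotaD big_cat.
rewrite -mulrA; apply: ler_wpM2l; first exact: growth_ge0.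
apply: le_trans (bernoulli_block k2).
apply: ler_wpM2r; last exact: prod_block (ltnW k1).
by rewrite subr_ge0; apply: le_trans (_ : 7 * 2 <= _); [lra | rewrite ler_pM2l].
Qed.

Lemma level_block k n : (0 < k)%N -> (210 * k <= n <= 210 * k.+1)%N ->
  level_bound n <= G (210 * k.+1) * ((168 * k%:R) ^+ 2)^-1.
Proof.
move=> k0 /andP[nk nk2].
apply: (le_trans (level_bound_tail _)); first lia.
rewrite mulrC; apply: ler_pM; first exact: growth_ge0.
- apply: mulr_ge0; first exact: (ler0n _ 25).
  by rewrite invr_ge0; apply: mulr_ge0; [exact: (ler0n _ 16) | exact: sqr_ge0].
- have -> : (210 * k.+1 = n + (210 * k.+1 - n))%N by lia.
  exact: growth_le.
- apply: square_block; first by rewrite ltr0n.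
  by rewrite -(natrM _ 210) ler_nat.
Qed.

Lemma total_block k : (1 < k)%N ->
  total_bound (210 * k.+1) <= total_bound (210 * k) + G (210 * k.+1) / (12 * (7 * k%:R) ^+ 2).
Proof.
move=> k1; have k0 : 0 < k%:R :> rat by rewrite ltr0n; lia.
have kn : k%:R != 0 :> rat by rewrite gt_eqF.
have -> : total_bound (210 * k.+1) =
    total_bound (210 * k) + \sum_(n <- iota (210 * k) 210 | prime n) level_bound n.
  by rewrite /total_bound mulnS addnC iotaD big_cat.
rewrite lerD2l.
have := @level_block k _ (ltnW k1).
have g0 := growth_ge0 (210 * k.+1); move: (G _) g0 => g g0 lb.
set c := g * ((168 * k%:R) ^+ 2)^-1.
have c0 : 0 <= c by apply: mulr_ge0 g0 _; rewrite invr_ge0; exact: sqr_ge0.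
apply: (@le_trans _ _ (\sum_(n <- iota (210 * k) 210 | prime n) c)).
  rewrite big_seq_cond [X in _ <= X]big_seq_cond; apply: ler_sum => n.
  rewrite mem_iota => /andP[/andP[nk nk2] _]; apply: lb.
  by rewrite nk mulnS addnC ltnW.
rewrite big_const_seq iter_addr_0.
rewrite (block_average g kn) -/c.
by apply: ler_wpMn2l c0 _ _ _; apply: count_prime_block; lia.
Qed.

(** By [potential_block], the decrease of the second term pays for all levels of the next block. *)
Lemma total_potential k j : (1 < k)%N ->
  total_bound (210 * (k + j)) + G (210 * (k + j)) / (84 * ((k + j)%:R - 1))
  <= total_bound (210 * k) + G (210 * k) / (84 * (k%:R - 1)).
Proof.
move=> k1; elim: j => [|j]; first by rewrite addn0.
apply: le_trans; rewrite addnS; move: (k + j)%N (leq_trans k1 (leq_addr j k)) => i i1.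
have := total_block i1; have := growth_block i1.
have := growth_ge0 (210 * i); have := growth_ge0 (210 * i.+1).
move: (G _) (G _) => g' g g'0 g0 gg tt.
have i2 : 2 <= i%:R :> rat by rewrite (ler_nat _ 2).
rewrite -[i.+1%:R]natr1 addrK; move: (i%:R) gg tt i2 => x gg tt x2.
have pb := potential_block x2 g0 g'0 gg.
by apply: (le_trans (lerD tt (lexx _))); rewrite -addrA lerD2l.
Qed.

End Tail.

(** * Certified computation up to 6300 *)

Section Computation.

Local Open Scope N_scope.

(** The primes below 83 decide primality below [83 * 83 = 6889], hence on the whole range up to
    6300. *)
Definition small_primes : seq N :=
  [:: 2; 3; 5; 7; 11; 13; 17; 19; 23; 29; 31; 37; 41; 43; 47; 53; 59; 61; 67;
      71; 73; 79].

Fixpoint trial_division (l : seq N) (n : N) : bool :=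
  if l is q :: l' then
    if N.eqb n q then true
    else if N.eqb (N.modulo n q) 0 then false else trial_division l' n
  else true.

(** Strictly above the quotient even when the division is exact; only an upper bound matters. *)
Definition ceil_div (a b : N) : N := N.succ (N.div a b).

(* [wmax dist n = wnum n / wden n]. *)
Definition wnum (n : N) : N := if N.ltb n 17 then 1 else 5.
Definition wden (n : N) : N := if N.ltb n 17 then n else N.mul 4 n.

Definition prodN (O : seq nat) : N := foldr (fun q => N.mul (N.of_nat q)) 1 O.

(* Five times [excess dist n (large_divisors (min_cofactor n) O)]. *)
Definition leaf (n : nat) (O : seq nat) : N :=
  let small := count (fun d => N.eqb (N.modulo (prodN O) (N.of_nat d)) 0)
                   (iota 1 (118 %/ n)) in
  N.sub (N.mul 5 (N.of_nat (2 ^ size O - small)%N)) (if (n < 17)%N then 0 else N.of_nat n).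

Fixpoint tree_num (k : nat) (g : seq nat -> N) (O : seq nat) : N :=
  if k is j.+1 then
    if prime j then
      let d := wden (N.of_nat j) in let a := wnum (N.of_nat j) in
      N.add (N.mul (N.sub d a) (tree_num j g O)) (N.mul a (tree_num j g (j :: O)))
    else tree_num j g O
  else g O.

Fixpoint tree_den (k : nat) : N :=
  if k is j.+1 then
    if prime j then N.mul (wden (N.of_nat j)) (tree_den j) else tree_den j
  else 1.

Definition scale : N := 10000000000.

(* Upper bounds, in units of [1 / scale], for [growth dist 1 n], [growth dist 3 n],
   [pmf dist n] on [0..10] and [total_bound n]. *)
Record state := State { s1 : N; s3 : N; pm : seq N; acc : N }.

Fixpoint pm_step (d a prev : N) (l : seq N) : seq N :=
  if l is x :: l' then
    ceil_div (N.add (N.mul (N.sub d a) x) (N.mul a prev)) d :: pm_step d a x l'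
  else [::].

(** Started at [pw = 5], each term is an entry of [l] times [n - 5 * 2 ^ j] truncated at 0, which is
    five times the deficit in [chain_excess]. *)
Fixpoint deficit (n pw : N) (l : seq N) : N :=
  if l is x :: l' then N.add (N.mul x (N.sub n pw)) (deficit n (N.mul 2 pw) l')
  else 0.

Definition level (n : N) (s : state) : N :=
  if N.ltb n 24 then
    let k := N.to_nat n in
    ceil_div (N.mul scale (N.mul (wnum n) (tree_num k (leaf k) [::])))
             (N.mul 5 (N.mul (wden n) (tree_den k)))
  else ceil_div (N.sub (N.add (N.mul 5 (s1 s)) (deficit n 5 (pm s))) (N.mul n scale))
                (N.mul 4 n).

Definition step (n : N) (s : state) : state :=
  if trial_division small_primes n then
    let d := wden n in let a := wnum n in
    State (ceil_div (N.mul (s1 s) (N.add d a)) d)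
          (ceil_div (N.mul (s3 s) (N.add d (N.mul 3 a))) d)
          (pm_step d a 0 (pm s))
          (N.add (acc s) (level n s))
  else s.

Fixpoint run (k : nat) (n : N) (s : state) : state :=
  if k is k'.+1 then run k' (N.succ n) (step n s) else s.

Definition start : state := State scale scale [:: scale; 0; 0; 0; 0; 0; 0; 0; 0; 0; 0] 0.

End Computation.


(** * Field inequalities behind the rounded steps *)

Section StepInequalities.

Local Open Scope ring_scope.

Variable R : realFieldType.
Implicit Types a b c d e x y : R.

Lemma max_scale5 x y : Num.max 0 (y - 5 * x) = 5 * Num.max 0 (y / 5 - x).
Proof. by case: (lerP 0 (y - 5 * x)); case: (lerP 0 (y / 5 - x)); lra. Qed.

Lemma growth_step (k a b c d e : R) : 0 <= k -> 0 <= d -> 0 <= b -> e * a <= c ->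
  e * (1 + k * d) * a * b <= c * (b + k * (d * b)).
Proof.
move=> k0 d0 b0 h.
have kd : 0 <= k * d by exact: mulr_ge0.
have : 0 <= b * (1 + k * d) * (c - e * a).
  by apply: mulr_ge0; [apply: mulr_ge0 => //; lra | lra].
lra.
Qed.

Lemma pmf_step (a b c d e x y : R) : 0 <= e -> 0 <= 1 - e -> 0 <= b ->
  x * a <= c -> y * a <= d ->
  ((1 - e) * x + e * y) * a * b <= (1 - e) * b * c + e * b * d.
Proof.
move=> e0 e1 b0 h1 h2.
have : 0 <= (1 - e) * b * (c - x * a) by apply: mulr_ge0; [exact: mulr_ge0 | lra].
have : 0 <= e * b * (d - y * a) by apply: mulr_ge0; [exact: mulr_ge0 | lra].
lra.
Qed.

Lemma level_step (a b c d : R) : d != 0 ->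
  5 / (4 * d) * (b - d / 5 + c) * a * (4 * d) = 5 * (b * a) + 5 * (c * a) - d * a.
Proof. by move=> d0; field; rewrite d0. Qed.

End StepInequalities.

(** * Soundness of the integer computation *)

Section Soundness.

Local Open Scope ring_scope.

(* Locked, lest a closing tactic turns [scale] into a unary number. *)
Definition toQ (x : N) : rat := locked (N.to_nat x)%:R.

Lemma toQE x : toQ x = (N.to_nat x)%:R.
Proof. by rewrite /toQ -lock. Qed.

Lemma toQ_nat n : toQ (N.of_nat n) = n%:R.
Proof. by rewrite toQE Nat2N.id. Qed.

Lemma toQD x y : toQ (N.add x y) = toQ x + toQ y.
Proof. by rewrite !toQE N2Nat.inj_add plusE natrD. Qed.

Lemma toQM x y : toQ (N.mul x y) = toQ x * toQ y.
Proof. by rewrite !toQE N2Nat.inj_mul multE natrM. Qed.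

Lemma toQ_ge0 x : 0 <= toQ x.
Proof. by rewrite toQE ler0n. Qed.

Lemma toQB x y : toQ (N.sub x y) = Num.max 0 (toQ x - toQ y).
Proof.
rewrite !toQE N2Nat.inj_sub minusE; case: (leqP (N.to_nat y) (N.to_nat x)) => h.
  by rewrite natrB // max_r // subr_ge0 ler_nat.
rewrite max_l; first by move: (ltnW h); rewrite -subn_eq0 => /eqP ->.
by rewrite subr_le0 ler_nat ltnW.
Qed.

Lemma toQ_gt0 x : (0 < N.to_nat x)%N -> 0 < toQ x.
Proof. by rewrite toQE ltr0n. Qed.

Lemma toQ_pos p : 0 < toQ (Npos p).
Proof. by apply: toQ_gt0; lia. Qed.

Lemma toQ_lt x y : N.ltb x y -> toQ x < toQ y.
Proof. by move/N.ltb_lt => h; rewrite !toQE ltr_nat; lia. Qed.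

Lemma ceil_div_ge a b (x : rat) :
  (0 < N.to_nat b)%N -> x * toQ b <= toQ a -> x <= toQ (ceil_div a b).
Proof.
move=> b0 h; have bQ := toQ_gt0 b0.
rewrite -(ler_pM2r bQ); apply: (le_trans h); rewrite -toQM !toQE ler_nat.
have bn : b <> 0%num by move=> e; rewrite e in b0.
have := N.mul_succ_div_gt a b bn; rewrite /ceil_div; lia.
Qed.

Lemma modN_eq0 a b : (0 < N.to_nat b)%N ->
  N.eqb (N.modulo a b) 0 = (N.to_nat b %| N.to_nat a)%N.
Proof.
move=> b0; have bn : b <> 0%num by move=> e; rewrite e in b0.
apply/N.eqb_spec/dvdnP => [/(N.mod_divide _ _ bn)[c ->] | [c h]].
  by exists (N.to_nat c); rewrite N2Nat.inj_mul multE.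
apply/(N.mod_divide _ _ bn); exists (N.of_nat c).
by apply: N2Nat.inj; rewrite N2Nat.inj_mul Nat2N.id multE.
Qed.

Lemma trial_divisionE l n : (forall q, q \in l -> prime (N.to_nat q)) ->
  trial_division l n =
  prime (N.to_nat n) || all (fun q => ~~ (N.to_nat q %| N.to_nat n)%N) l.
Proof.
elim: l => [|q l IH] lp /=; first by rewrite orbT.
have pq : prime (N.to_nat q) by apply: lp; rewrite inE eqxx.
rewrite modN_eq0 ?prime_gt0 // IH; last by move=> r rl; apply: lp; rewrite inE rl orbT.
case: N.eqb_spec => [->|nq]; first by rewrite pq.
case: (boolP (_ %| _)%N) => //= qn; rewrite orbF.
apply/esym/negbTE; apply/negP => pn; apply: nq; apply: N2Nat.inj; apply/eqP.
by rewrite eq_sym -dvdn_prime2.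
Qed.

Lemma trial_division_prime n : (1 < n < 83 * 83)%N ->
  trial_division small_primes (N.of_nat n) = prime n.
Proof.
case/andP=> n1 nle; rewrite trial_divisionE ?Nat2N.id; last first.
  apply/allP; have : all (fun q => prime (N.to_nat q)) small_primes by vm_compute.
  by [].
case: (boolP (prime n)) => // pn; rewrite orFb; apply/negbTE/allPn.
have p83 : (pdiv n < 83)%N.
  rewrite ltnNge; apply: contra pn => p83; apply: ltn_pdiv2_prime; first exact: ltnW.
  by apply: (leq_trans nle); rewrite expnS expn1 leq_mul.
have /allP/(_ (pdiv n)) : all (fun q => prime q ==> (N.of_nat q \in small_primes)) (iota 0 83).
  by vm_compute.
rewrite mem_iota p83 => /(_ isT); rewrite pdiv_prime // => mp.
by exists (N.of_nat (pdiv n)) => //; rewrite Nat2N.id pdiv_dvd.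
Qed.

Local Notation w := (wmax dist).

Lemma wden_gt0 k : (0 < k)%N -> (0 < N.to_nat (wden (N.of_nat k)))%N.
Proof. by move=> k0; rewrite /wden; case: ifP => _; lia. Qed.

Lemma wnum_wden k : (0 < k)%N ->
  toQ (wnum (N.of_nat k)) = w k * toQ (wden (N.of_nat k)).
Proof.
move=> k0; have kn : k%:R != 0 :> rat by rewrite pnatr_eq0 -lt0n.
rewrite /wnum /wden; case: N.ltb_spec => h.
  by rewrite wmax_small ?toQ_nat ?mulVf ?(toQ_nat 1) //; lia.
rewrite wmax_large ?toQM ?toQ_nat ?(toQ_nat 5) ?(toQ_nat 4); last lia.
by rewrite mulfVK // mulf_neq0.
Qed.

Lemma toQ_sub_wden k : prime k ->
  toQ (N.sub (wden (N.of_nat k)) (wnum (N.of_nat k))) =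
  (1 - w k) * toQ (wden (N.of_nat k)).
Proof.
move=> pk; rewrite toQB wnum_wden ?prime_gt0 // mulrBl mul1r max_r //.
by rewrite -{1}[toQ _]mul1r -mulrBl mulr_ge0 ?toQ_ge0 // subr_ge0 wmax_le1 //; exact: dist_le.
Qed.

Lemma tree_den_gt0 n : (0 < N.to_nat (tree_den n))%N.
Proof.
elim: n => //= n IH; case: ifP => // pn.
by rewrite N2Nat.inj_mul multE muln_gt0 (wden_gt0 (prime_gt0 pn)) IH.
Qed.

Lemma tree_numE n g gN O : (forall O', 5%:R * g O' = toQ (gN O')) ->
  5%:R * tree dist n g O * toQ (tree_den n) = toQ (tree_num n gN O).
Proof.
move=> gE; elim: n O => [|n IH] O /=.
  by rewrite gE (toQ_nat 1) mulr1.
case: ifP => // pn; rewrite toQD !toQM toQ_sub_wden // wnum_wden ?prime_gt0 //.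
rewrite -!IH; move: (toQ _) (toQ _) (tree _ _ _ _) (tree _ _ _ _) (w n) => a b c d e; ring.
Qed.

Lemma prodNE O : N.to_nat (prodN O) = (\prod_(q <- O) q)%N.
Proof.
elim: O => [|q O IH]; first by rewrite big_nil.
by rewrite big_cons -IH /= N2Nat.inj_mul Nat2N.id multE.
Qed.

Lemma leafE n O :
  5%:R * (excess dist n \o large_divisors (min_cofactor n)) O = toQ (leaf n O).
Proof.
rewrite /leaf toQB toQM toQ_nat (toQ_nat 5) /= /large_divisors /=.
rewrite [count (fun d => N.eqb _ _) _](@eq_in_count _ _ (dvdn^~ (\prod_(q <- O) q)%N)); last first.
  move=> d; rewrite mem_iota => /andP[d0 _].
  by rewrite modN_eq0 Nat2N.id // prodNE.
move: (2 ^ _ - _)%N => k; rewrite /excess /dist.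
have k0 : 0 <= k%:R :> rat by rewrite ler0n.
case: ifP => n17.
  rewrite (toQ_nat 0) mulr0 !subr0 !max_r //.
  by apply: mulr_ge0 => //; exact: (ler0n _ 5).
rewrite toQ_nat; move: (k%:R) (n%:R) => x y.
by case: (lerP 0 (x - y * (1 / 5))); case: (lerP 0 (5%:R * x - y)); lra.
Qed.

Record state_bounds (n : nat) (s : state) : Prop := StateBounds {
  inv_s1 : growth dist 1 n * toQ scale <= toQ (s1 s);
  inv_s3 : growth dist 3 n * toQ scale <= toQ (s3 s);
  inv_size : size (pm s) = 11;
  inv_pm : forall j, (j < 11)%N -> pmf dist n j * toQ scale <= toQ (nth 0%num (pm s) j);
  inv_acc : total_bound n * toQ scale <= toQ (acc s) }.

Lemma size_pm_step d a p l : size (pm_step d a p l) = size l.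
Proof. by elim: l p => //= x l IH p; rewrite IH. Qed.

Lemma nth_pm_step d a p l j : (j < size l)%N ->
  nth 0%num (pm_step d a p l) j =
  ceil_div (N.add (N.mul (N.sub d a) (nth 0%num l j)) (N.mul a (nth 0%num (p :: l) j))) d.
Proof. by elim: l p j => [|x l IH] p [|j] // jl; exact: IH x j jl. Qed.

Lemma deficitE n pw l :
  toQ (deficit n pw l) =
  \sum_(j < size l) toQ (nth 0%num l j) * Num.max 0 (toQ n - toQ pw * (2 ^ j)%:R).
Proof.
elim: l pw => [|x l IH] pw; first by rewrite big_ord0 (toQ_nat 0).
rewrite -[deficit n pw (x :: l)]/(N.add (N.mul x (N.sub n pw)) (deficit n (N.mul 2 pw) l)).
rewrite -[size (x :: l)]/(size l).+1 big_ord_recl toQD toQM toQB IH.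
rewrite expn0 mulr1; congr (_ + _); apply: eq_bigr => j _.
by rewrite toQM (toQ_nat 2) expnS natrM [2%:R * toQ pw]mulrC mulrA.
Qed.

Lemma level_ge n s : (1 < n)%N -> (n <= 5 * 2 ^ 11)%N -> prime n ->
  state_bounds n s -> level_bound n * toQ scale <= toQ (level (N.of_nat n) s).
Proof.
move=> n1 nle pn [i1 _ isz ipm _]; have n0 := prime_gt0 pn.
rewrite /level_bound /level Nat2N.id; case: N.ltb_spec => h.
  rewrite ifT; last lia.
  apply: ceil_div_ge.
    rewrite !N2Nat.inj_mul !multE !muln_gt0 tree_den_gt0 wden_gt0 //.
  rewrite !toQM (toQ_nat 5) wnum_wden // -(tree_numE n [::] (leafE n)).
  move: (toQ scale) (toQ _) (toQ _) (w n) (tree _ _ _ _) => a b c d e.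
  (* The tree is evaluated without rounding, so both sides agree before the final ceiling. *)
  by rewrite le_eqVlt; apply/orP; left; apply/eqP; ring.
rewrite ifF; last lia.
rewrite chain_excess; last lia.
rewrite wmax_large; last lia.
apply: ceil_div_ge; first lia.
have nn : n%:R != 0 :> rat by rewrite pnatr_eq0 -lt0n.
rewrite toQB toQD !toQM deficitE isz toQ_nat (toQ_nat 5) (toQ_nat 4) le_max; apply/orP; right.
rewrite -[iota 0 11]/(index_iota 0 11) big_mkord.
set S := \sum_(j < 11) _; set S' := \sum_(j < 11) _.
have SS : 5%:R * (S * toQ scale) <= S'.
  rewrite /S /S' big_distrl big_distrr /=; apply: ler_sum => j _.
  rewrite max_scale5; have u0 : 0 <= Num.max 0 (n%:R / 5 - (2 ^ j)%:R) :> rat.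
    by rewrite le_max lexx.
  rewrite [X in _ <= X]mulrCA; apply: ler_wpM2l; first exact: (ler0n _ 5).
  by rewrite -mulrA [X in _ <= X]mulrC; apply: (ler_wpM2l u0); exact: ipm.
rewrite (level_step _ _ _ nn).
rewrite lerD2r; apply: lerD => //; apply: ler_wpM2l => //; exact: (ler0n _ 5).
Qed.

Lemma step_inv n s : (1 < n)%N -> (n < 83 * 83)%N ->
  state_bounds n s -> state_bounds n.+1 (step (N.of_nat n) s).
Proof.
move=> n1 nle inv.
rewrite /step trial_division_prime ?n1 //; case: (boolP (prime n)) => [pn | /negbTE pn].
  have n0 := prime_gt0 pn; have dn := wden_gt0 n0.
  have lv : level_bound n * toQ scale <= toQ (level (N.of_nat n) s).
    by apply: level_ge => //; apply: (leq_trans (ltnW nle)).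
  case: inv => i1 i3 isz ipm iacc.
  have w1 : 0 <= 1 - w n by rewrite subr_ge0 wmax_le1 //; exact: dist_le.
  have w0 : 0 <= w n by exact: wmax_ge0 dist_le n.
  have d0 := toQ_ge0 (wden (N.of_nat n)).
  split; cbn [s1 s3 pm acc].
  - rewrite growthS pn; apply: ceil_div_ge => //; rewrite toQM toQD wnum_wden //.
    by rewrite -[w n * toQ _]mul1r; apply: growth_step.
  - rewrite growthS pn; apply: ceil_div_ge => //; rewrite toQM toQD toQM (toQ_nat 3) wnum_wden //.
    by apply: growth_step => //; exact: (ler0n _ 3).
  - by rewrite size_pm_step.
  - move=> j j11; rewrite nth_pm_step ?isz //; apply: ceil_div_ge => //.
    rewrite pmfS pn toQD !toQM toQ_sub_wden // wnum_wden //.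
    have h1 := ipm j j11.
    have h2 : (if j is i.+1 then pmf dist n i else 0) * toQ scale <=
              toQ (nth 0%num (0%num :: pm s) j).
      by case: (j) j11 => [|i] i11 /=; [rewrite mul0r toQ_ge0 | exact/ipm/ltnW].
    exact: pmf_step.
  - by rewrite totalS pn mulrDl toQD lerD.
case: inv => i1 i3 isz ipm iacc; split=> //.
- by rewrite growthS pn mulr1.
- by rewrite growthS pn mulr1.
- by move=> j; rewrite pmfS pn; exact: ipm.
- by rewrite totalS pn addr0.
Qed.

Lemma run_inv k n s : (1 < n)%N -> (n + k <= 83 * 83)%N ->
  state_bounds n s -> state_bounds (n + k) (run k (N.of_nat n) s).
Proof.
elim: k n s => [|k IH] n s n1 nk inv; first by rewrite addn0.
rewrite addnS -addSn /= -Nat2N.inj_succ; apply: IH; [lia | lia |].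
by apply: step_inv => //; lia.
Qed.

Lemma start_inv : state_bounds 2 start.
Proof.
have g c : growth dist c 2 = 1 by rewrite !growthS /= !mulr1 /growth big_nil.
split; cbn [s1 s3 pm acc start].
- by rewrite g mul1r.
- by rewrite g mul1r.
- by [].
- move=> j _; rewrite /pmf /=; case: j => [|j]; first by rewrite mul1r.
  by rewrite mul0r; exact: toQ_ge0.
- by rewrite !totalS /= !addr0 /total_bound big_nil mul0r; exact: toQ_ge0.
Qed.

End Soundness.

(** * Conclusion *)

(** The potential at [k = 30] is below 1, with the denominator [84 * (k - 1)] cleared. *)
Definition potential_check (s : state) : bool :=
  N.ltb (N.add (N.mul (N.mul 84 29) (acc s)) (s3 s)) (N.mul (N.mul 84 29) scale).

Lemma final_check : potential_check (run (210 * 30 - 2) 2 start).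
Proof. by vm_compute. Qed.

Section Conclusion.

Local Open Scope ring_scope.

Lemma potential_lt1 (a g c k s z : rat) : 0 < s -> 0 < c ->
  a * s <= k -> g * s <= z -> c * k + z < c * s -> a + g / c < 1.
Proof.
move=> s0 c0 ak gz h; rewrite -(ltr_pM2r c0) mul1r mulrDl divfK ?gt_eqF //.
rewrite -(ltr_pM2r s0); apply: le_lt_trans h.
rewrite mulrDl lerD // mulrAC mulrC; exact: ler_wpM2l (ltW c0) _ _ ak.
Qed.

Lemma potential_of_state n s : state_bounds n s -> potential_check s ->
  total_bound n + growth dist 3 n / (84 * (30%:R - 1)) < 1.
Proof.
case=> _ i3 _ _ ia /toQ_lt h.
have -> : 84 * (30%:R - 1) = toQ (N.mul 84 29).
  by rewrite toQM (toQ_nat 84) (toQ_nat 29); ring.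
apply: potential_lt1 ia i3 _; [exact: toQ_pos | exact: toQ_pos |].
by move: h; rewrite toQD !(toQM (N.mul 84 29)).
Qed.

Lemma potential_start :
  total_bound (210 * 30) + growth dist 3 (210 * 30) / (84 * (30%:R - 1)) < 1.
Proof.
apply: potential_of_state final_check.
exact: (@run_inv (210 * 30 - 2) 2 start isT isT start_inv).
Qed.

Lemma total_bound_lt1 j : total_bound (210 * (30 + j)) < 1.
Proof.
apply: le_lt_trans potential_start.
apply: le_trans (total_potential j (isT : (1 < 30)%N)).
rewrite lerDl; apply: mulr_ge0; first exact: growth_ge0.
rewrite invr_ge0; apply: mulr_ge0; first exact: (ler0n _ 84).
by rewrite subr_ge0 ler1n.
Qed.

Lemma layer_bound_le (I : finType) (m : I -> nat) n :
  injective m -> (forall i, squarefree (m i)) -> (forall i, 119 <= m i)%N ->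
  prime n -> layer_bound m dist n <= level_bound n.
Proof.
move=> minj msf m119 pn; rewrite /layer_bound /level_bound mulrC.
apply: ler_wpM2l; first exact: wmax_ge0 dist_le n.
have m0 i : (0 < m i)%N by apply: leq_trans (m119 i).
have dm i : i \in layer m n -> (n %| m i)%N.
  by rewrite mem_filter => /andP[/eqP <- _]; exact: max_pdiv_dvd.
have hO : {in layer m n, forall i q, q \in primes (m i) -> [|| (q < n)%N, q == n | q \in [::]]}.
  move=> i; rewrite mem_filter => /andP[/eqP mi _] q qm.
  by rewrite orbF orbC -leq_eqVlt -mi; exact: max_pdiv_max.
have uL : uniq (layer m n) by rewrite filter_uniq ?enum_uniq.
have [fle _] := excess_convex_nondecr dist_ge0 n.
case: ifP => n24.
  apply: (dom_le_tree dist_le (p := n)) => // i iL.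
  (* [119 <= m i] forces the cofactor to exceed [118 %/ n]. *)
  by rewrite dm // /min_cofactor ltn_divLR ?prime_gt0 // divnK ?dm // m119.
rewrite -tree_large_divisors1.
apply: (dom_le_tree dist_le (p := n)) => // i iL.
by rewrite dm // divn_gt0 ?prime_gt0 // dvdn_leq ?dm.
Qed.

End Conclusion.

(** * From points to integers by the Chinese remainder theorem *)

Lemma chinese_primes (v : nat -> nat) M :
  exists x : nat, forall q, q < M -> prime q -> x = v q %[mod q].
Proof.
elim: M => [|M [x IH]]; first by exists 0.
case: (boolP (prime M)) => pM; last first.
  exists x => q; rewrite ltnS leq_eqVlt => /orP[/eqP -> | qM]; last exact: IH.
  by rewrite (negbTE pM).
(* The factorial serves as a common modulus for the earlier primes: each divides it, and it is
   coprime to the prime [M]. *)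
have co : coprime (M.-1)`! M.
  rewrite coprime_sym prime_coprime // fact_prod Euclid_dvd_prod // big_has.
  apply/hasPn => d; rewrite mem_index_iota => /andP[d0 dM].
  by rewrite gtnNdvd // (leq_trans dM) ?prednK ?prime_gt0.
exists (chinese (M.-1)`! M x (v M)) => q; rewrite ltnS leq_eqVlt => /orP[/eqP -> _ | qM pq].
  exact: chinese_modr.
rewrite -(IH q qM pq); have qf : q %| (M.-1)`!.
  by apply: dvdn_fact; rewrite prime_gt0 //= -ltnS prednK ?prime_gt0.
by rewrite -(modn_dvdm _ qf) chinese_modl // modn_dvdm.
Qed.

Lemma residue_eq (x : nat) (a : int) (q m : nat) : q %| m ->
  (x%:Z = a %[mod m%:Z])%Z -> x %% q = `|(a %% q%:Z)%Z|%N.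
Proof.
move=> qm /eqP; rewrite eqz_mod_dvd => h.
have : (x%:Z == a %[mod q%:Z])%Z by rewrite eqz_mod_dvd; exact: dvdz_trans h.
by move/eqP <-; rewrite modz_nat.
Qed.

Theorem theorem1 (r : nat) (a : 'I_r -> int) (m : 'I_r -> nat)
  (hcov : covering_system a m)
  (hdist : injective m)
  (hsqf : forall j, squarefree (m j)) :
  exists2 j : 'I_r, (forall i : 'I_r, m j <= m i) & m j <= 118.
Proof.
(* Covering 0 provides an index, so a least modulus exists. *)
case: hcov => m_gt0 cov; have [j0 _] := cov 0%R.
have [j _ jmin] := @arg_minnP _ j0 xpredT m isT.
exists j => [i|]; first exact: jmin.
rewrite leqNgt; apply/negP => j119.
have m119 i : 119 <= m i by apply: leq_trans (jmin i isT).
have m_gt1 i : 1 < m i by apply: leq_trans (m119 i).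
pose res (i : 'I_r) q := `|(a i %% q%:Z)%Z|%N.
(* Larger than every modulus, and of the form for which [total_bound_lt1] applies. *)
pose M := 210 * (30 + \max_i m i).
have allbad v : exists2 n, n < M & bad m res n v.
  (* An integer with the residues of [v] satisfies some congruence [i], so [v] is bad at the largest
     prime factor of [m i]. *)
  have [x xv] := chinese_primes v M; have [i xi] := cov (Posz x).
  have miM : m i < M by have := leq_bigmax (F := m) i; rewrite /M; lia.
  exists (max_pdiv (m i)); first by apply: leq_ltn_trans miM; exact: max_pdiv_leq.
  apply/existsP; exists i; rewrite eqxx; apply/allP => q.
  rewrite mem_primes => /and3P[pq _ qm]; apply/implyP => _.
  rewrite -(xv q) //; first by apply/eqP; exact: residue_eq xi.
  by apply: leq_ltn_trans miM; exact: dvdn_leq.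
have := not_always_bad m_gt1 dist_ge0 dist_le allbad.
rewrite leNgt => /negP; apply.
apply: le_lt_trans (total_bound_lt1 (\max_i m i)).
by apply: ler_sum => n pn; exact: layer_bound_le.
Qed.
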